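(* Let $(\Omega,\mathcal{A},\mu)$ be a probability space with $\mu$ complete, let $\Sigma$ be a sub-$\sigma$-algebra of $\mathcal{A}$, and let $E$ be the natural domain of $T=\mathbb{E}[\,\cdot\,|\Sigma]$. Let $\tau:\Omega\to\Omega$ be a map such that for every $A\in\mathcal{A}$: $\tau^{-1}(A)\in\mathcal{A}$; $\mathbb{E}[\chi_{\tau^{-1}(A)}|\Sigma]=\mathbb{E}[\chi_A|\Sigma]$; and there is $B_A\in\mathcal{A}$ with $\mu(A\,\Delta\,\tau^{-1}(B_A))=0$. Let $Sf:=f\circ\tau$ for $f\in E$, and suppose that the system $(E,T,S,\mathbf{1})$ is conditionally ergodic. Then for each $A\in\mathcal{A}$, $$\mathbb{E}[n_A|\Sigma]=\chi_{\{x\in\Omega\,:\,\mathbb{P}[A|\Sigma](x)>0\}}\quad\text{a.e.}$$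
   Context: $\mathbb{N}=\{1,2,3,\dots\}$; $\mathbf{n}$ denotes (the class of) the function with constant value $n$. The natural domain $E$ of $\mathbb{E}[\cdot|\Sigma]$ is the space of a.e. equivalence classes of measurable functions $f:\Omega\to\mathbb{R}$ for which the sequence $(\mathbb{E}[\min(|f|,\mathbf{n})|\Sigma])_{n\in\mathbb{N}}$ is bounded above by an a.e. finite valued measurable function. One has $L^1(\Omega,\mathcal{A},\mu)\subset E$, and $\mathbb{E}[\cdot|\Sigma]$ is extended to $T:E\to E$ by the a.e. pointwise limits $$Tf=\lim_{n\to\infty}\mathbb{E}[\min(f^+,\mathbf{n})|\Sigma]-\lim_{n\to\infty}\mathbb{E}[\min(f^-,\mathbf{n})|\Sigma],\quad f\in E.$$ The system is conditionally ergodic if every $f\in E$ with $f\circ\tau=f$ a.e. belongs to the range $R(T)$ of $T$. $\mathbb{P}[A|\Sigma]=\mathbb{E}[\chi_A|\Sigma]$ is the conditional probability of $A$ given $\Sigma$. The first recurrence time with respect to $A\in\mathcal{A}$ is $n_A(x)=\inf\{n\in\mathbb{N} : \tau^nx\in A\}$ for $x\in A$ (the set on the right is nonempty for a.e. $x\in A$), and $n_A(x)=0$ for $x\notin A$. *)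

(* Defs.v *)
From HB Require Import structures.
From mathcomp Require Export all_boot all_order all_algebra.
From mathcomp Require Export all_classical all_reals all_analysis.
From mathcomp Require Export measurable_realfun.
Set Implicit Arguments.
Unset Strict Implicit.
Unset Printing Implicit Defensive.
Import Order.TTheory GRing.Theory Num.Theory.
Import numFieldNormedType.Exports.
Local Open Scope classical_set_scope.
Local Open Scope ring_scope.

(* Elements of the function spaces are represented by genuine functions
   Omega -> R; equality of classes is equality almost everywhere. *)

Definition sub_sigma_algebra d (Omega : measurableType d)
    (Sigma : set (set Omega)) : Prop :=
  sigma_algebra [set: Omega] Sigma /\ Sigma `<=` measurable.

(* g is a version of the conditional expectation of f given Sigma; since Sigma
   is a sigma-algebra, the measurable sets of g_sigma_algebraType Sigma are
   exactly the elements of Sigma. *)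
Definition is_cond_exp d (Omega : measurableType d) (R : realType)
    (P : probability Omega R) (Sigma : set (set Omega))
    (f g : Omega -> R) : Prop :=
  [/\ measurable_fun [set: g_sigma_algebraType Sigma]
        (g : g_sigma_algebraType Sigma -> R),
      P.-integrable [set: Omega] (EFin \o g) &
      forall B, Sigma B ->
        (\int[P]_(x in B) (g x)%:E = \int[P]_(x in B) (f x)%:E)%E].

(* A chosen version of E[f | Sigma], meaningful for f in L^1. Versions exist
   by Radon-Nikodym and are a.e. unique, so a.e. statements do not depend on
   the choice. *)
Definition cond_exp d (Omega : measurableType d) (R : realType)
    (P : probability Omega R) (Sigma : set (set Omega))
    (f : Omega -> R) : Omega -> R :=
  xget (cst 0) [set g | is_cond_exp P Sigma f g].

Definition cond_prob d (Omega : measurableType d) (R : realType)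
    (P : probability Omega R) (Sigma : set (set Omega))
    (A : set Omega) : Omega -> R :=
  cond_exp P Sigma (\1_A).

(* The truncations are at n.+1 because the index n ranges over {1, 2, ...}. *)
Definition cond_exp_trunc d (Omega : measurableType d) (R : realType)
    (P : probability Omega R) (Sigma : set (set Omega))
    (f : Omega -> R) (n : nat) : Omega -> R :=
  cond_exp P Sigma (fun x => Num.min (f x) n.+1%:R).

(* The natural domain E of the conditional expectation. *)
Definition natural_domain d (Omega : measurableType d) (R : realType)
    (P : probability Omega R) (Sigma : set (set Omega))
    (f : Omega -> R) : Prop :=
  measurable_fun [set: Omega] f /\
  exists h : Omega -> \bar R,
    [/\ measurable_fun [set: Omega] h,
        {ae P, forall x, h x \is a fin_num} &
        forall n, {ae P, forall x,
          ((cond_exp_trunc P Sigma (fun y => `|f y|) n x)%:E <= h x)%E}].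

(* The extension T of the conditional expectation to E. For f in E both limits
   exist at almost every x; elsewhere limn returns an irrelevant value. *)
Definition ext_cond_exp d (Omega : measurableType d) (R : realType)
    (P : probability Omega R) (Sigma : set (set Omega))
    (f : Omega -> R) : Omega -> R :=
  fun x => limn (fun n => cond_exp_trunc P Sigma (f^\+) n x)
         - limn (fun n => cond_exp_trunc P Sigma (f^\-) n x).

(* Every S-invariant element of E, where S f = f \o tau, lies in the range of
   T : E -> E. *)
Definition conditionally_ergodic d (Omega : measurableType d) (R : realType)
    (P : probability Omega R) (Sigma : set (set Omega))
    (tau : Omega -> Omega) : Prop :=
  forall f : Omega -> R, natural_domain P Sigma f ->
    f \o tau = f %[ae P] ->
    exists2 g : Omega -> R, natural_domain P Sigma g &
      f = ext_cond_exp P Sigma g %[ae P].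

(* The infimum is taken in \bar R, so the value is +oo at the points of A that
   never return to A. *)
Definition recurrence_time (R : realType) (Omega : Type)
    (tau : Omega -> Omega) (A : set Omega) (x : Omega) : \bar R :=
  if x \in A then
    ereal_inf [set (n%:R)%:E | n in [set n | (0 < n)%N /\ A (iter n tau x)]]
  else 0%E.

(* Main.v *)
From HB Require Import structures.
Require Import Defs.
Import Order.TTheory GRing.Theory Num.Theory.
Import numFieldNormedType.Exports.
Local Open Scope classical_set_scope.
Local Open Scope ring_scope.

(** Write U_n ([hits]) for the set of points whose orbit, time 0 included, meets
    A before time n, and U ([hit]) for the union of the U_n, so that U_0 is empty
    and U_(n+1) is the union of A and tau^-1(U_n).

    Integrating the invariance hypothesis over a set C of Sigma gives
    P(C /\ tau^-1 B) = P(C /\ B) for every measurable B.  A point x of A has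
    n_A(x) > k exactly when tau x is not in U_k, hence n_A is the sum over k
    of the indicators of A \ tau^-1(U_k) ([recurrence_timeE]).  Since
      P(C /\ U_(k+1)) = P(C /\ tau^-1 U_k) + P(C /\ (A \ tau^-1 U_k))
    and the first term on the right is P(C /\ U_k), the integrals of these
    indicators over C telescope, and the integral of n_A over C equals
    P(C /\ U) ([integral_recurrence_time]).  With C the whole space this
    bounds the integral of n_A by 1, which gives the a.e. finiteness of n_A
    and its membership in the natural domain.

    It remains to identify U with Q = {P[A|Sigma] > 0} ([pos]) up to a null set
    ([ae_hit_pos]).  The set A is a.e. contained in Q because P[A|Sigma] <= 0
    off Q, and the telescoped sum over the complement of Q carries this over
    to U.  Conversely tau^-1(U) is contained in U and has
    the same measure, so the indicator of U is invariant; by conditional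
    ergodicity U is a.e. equal to a set C of Sigma.  As A is contained in U,
    the integral of P[A|Sigma] over Q \ C, that is P(A /\ Q \ C), vanishes, so
    Q \ C is a null set.  Thus the indicator of Q is a version of
    E[n_A|Sigma].

    The first two parts supply what this needs about conditional expectations:
    existence of versions by Radon-Nikodym, monotonicity, and the fact that on
    nonnegative integrable functions the extension T is the ordinary
    conditional expectation ([ext_cond_expE]). *)

(** * Integrals and pointwise limits *)

Lemma integral_le0_null d (T : measurableType d) (R : realType)
    (mu : {measure set T -> \bar R}) (B : set T) (h : T -> R) :
  measurable B -> measurable_fun B h -> (forall x, B x -> 0 < h x) ->
  (\int[mu]_(x in B) (h x)%:E <= 0)%E -> mu B = 0%E.
Proof.
move=> mB mh h0 inth.
have /(ae_eq_integral_abs mu mB) : (\int[mu]_(x in B) `|(h x)%:E| = 0)%E.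
  apply/eqP; rewrite eq_le integral_ge0// andbT; apply: le_trans inth.
  rewrite le_eqVlt; apply/orP; left; apply/eqP.
  apply: eq_integral => x /[!inE] Bx.
  by rewrite gee0_abs// lee_fin ltW// h0.
have mhE : measurable_fun B (EFin \o h) by exact/measurable_EFinP.
move=> /(_ mhE) hB0; apply: (measure_negligible mB).
apply: negligibleS hB0 => x Bx /= /(_ Bx) [] /eqP.
by rewrite gt_eqF// h0.
Qed.

(** Where the sequence diverges, [limn] is the constant [point]; the set of
    convergence is measurable, being the set where the upper and lower limits
    agree and are finite. *)
Lemma measurable_fun_limn d (T : measurableType d) (R : realType)
    (u : (T -> R)^nat) : (forall n, measurable_fun [set: T] (u n)) ->
  measurable_fun [set: T] (fun x => limn (u ^~ x)).
Proof.
move=> mu.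
pose s x := limn_esup (fun n => (u n x)%:E).
pose i x := limn_einf (fun n => (u n x)%:E).
have ms : measurable_fun setT s.
  by apply: measurable_fun_limn_esup => n; exact/measurable_EFinP.
have mi : measurable_fun setT i.
  apply: measurableT_comp => //; apply: measurable_fun_limn_esup => n.
  by apply: measurableT_comp => //; exact/measurable_EFinP.
rewrite (_ : (fun _ => _) = fun x =>
    if (s x == i x) && (s x \is a fin_num) then fine (s x) else point);
    last first.
  apply/funext => x; case: ifPn => [/andP[/eqP si sfin]|nsi].
    apply/cvg_lim => //.
    suff : (u n x)%:E @[n --> \oo] --> (fine (s x))%:E by move/fine_cvgP => [].
    rewrite fineK//; apply: (squeeze_cvge (f := einfs (fun n => (u n x)%:E))
        (h := esups (fun n => (u n x)%:E))).
    - apply: nearW => n; apply/andP; split.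
        by apply: ereal_inf_lbound; exists n => /=.
      by apply: ereal_sup_ubound; exists n => /=.
    - by rewrite si /i limn_einf_lim; exact: is_cvg_einfs.
    - by rewrite /s limn_esup_lim; exact: is_cvg_esups.
  apply/dvgP => ul; move/negP : nsi; apply.
  have {}ul : (u n x)%:E @[n --> \oo] --> (limn (u ^~ x))%:E.
    by apply: cvg_EFin => //; exact: nearW.
  by rewrite /s /i !(cvg_limn_einf_sup ul) eqxx.
apply: measurable_fun_ifT => //.
  apply: measurable_and.
    exact: measurable_fun_eqe.
  apply: (measurable_fun_bool true) => /=.
  by have := emeasurable_fin_num measurableT ms; rewrite setTI.
exact: measurableT_comp.
Qed.

(** * Conditional expectations *)

Section conditional_expectation.
Local Set Implicit Arguments.
Local Unset Strict Implicit.
Context d (Omega : measurableType d) (R : realType) (P : probability Omega R).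
Variables (Sigma : set (set Omega)) (subSigma : sub_sigma_algebra Sigma).
Local Notation OmegaS := (g_sigma_algebraType Sigma).
Implicit Types f g : Omega -> R.

Lemma measurable_subE (B : set Omega) : measurable (B : set OmegaS) <-> Sigma B.
Proof. by rewrite measurable_g_measurableTypeE//; case: subSigma. Qed.

Lemma sub_measurable (B : set Omega) : Sigma B -> measurable B.
Proof. by case: subSigma => _; exact. Qed.

Lemma measurable_fun_sub d' (U : measurableType d') (g : Omega -> U) :
  measurable_fun [set: OmegaS] (g : OmegaS -> U) -> measurable_fun [set: Omega] g.
Proof.
move=> mg _ Y mY; apply: sub_measurable; apply/measurable_subE.
exact: (mg measurableT).
Qed.

Let idS : Omega -> OmegaS := id.

Let measurable_idS : measurable_fun [set: Omega] idS.
Proof. by apply: measurable_fun_sub; exact: measurable_id. Qed.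

HB.instance Definition _ := isMeasurableFun.Build _ _ _ _ idS measurable_idS.

(** The density on Sigma, by Radon-Nikodym, of the charge B |-> E[f; B] with
    respect to P, both transported to Sigma along the identity. *)
Lemma is_cond_exp_ex f : P.-integrable [set: Omega] (EFin \o f) ->
  exists g, is_cond_exp P Sigma f g.
Proof.
move=> intf.
pose nuS : {charge set OmegaS -> \bar R} :=
  measure_function_pushforward__canonical__charge_Charge
    (induced_charge intf) measurable_idS.
pose muS : probability OmegaS R := distribution P idS.
have nu_mu : nuS `<< muS.
  apply: dominates_pushforward => //.
  apply/null_content_dominatesP => B mB PB0.
  by apply: null_set_integral => //; exact/measurable_funTS/(measurable_int P).
have intRN := Radon_Nikodym_integrable nu_mu.
pose h := Radon_Nikodym nuS muS.
pose g : OmegaS -> R := fine \o h.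
have gE x : h x = (g x)%:E.
  by rewrite fineK//; exact: Radon_Nikodym_fin_num.
have mg : measurable_fun [set: OmegaS] g.
  by apply: measurableT_comp => //; exact: measurable_int intRN.
have intg : P.-integrable [set: Omega] (EFin \o g).
  apply/integrableP; split.
    by apply/measurable_EFinP; exact: measurable_fun_sub mg.
  have /integrableP[_] := intRN.
  rewrite ge0_integral_pushforward//=; last first.
    by apply: measurableT_comp => //; exact: measurable_int intRN.
  apply: le_lt_trans; rewrite preimage_setT le_eqVlt; apply/orP; left; apply/eqP.
  by apply: eq_integral => x _; rewrite /= -[RHS]/(`|h x|%E) gE.
exists g; split => // B SB.
have mB : measurable (B : set OmegaS) by exact/measurable_subE.
transitivity (nuS B) => //.
rewrite (Radon_Nikodym_integral nu_mu mB) integral_pushforward//.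
- by apply: eq_integral => x _ /=; rewrite -gE.
- apply: (@integrableS _ _ _ _ setT) => //; first exact: sub_measurable.
  by apply: eq_integrable intg => // x _ /=; rewrite -gE.
Qed.

(** The set where g exceeds g' belongs to Sigma, and there g - g' has integral
    E[f - f'; B] <= 0 although it is positive. *)
Lemma is_cond_exp_le f f' g g' :
  P.-integrable [set: Omega] (EFin \o f) ->
  P.-integrable [set: Omega] (EFin \o f') ->
  (forall x, f x <= f' x) ->
  is_cond_exp P Sigma f g -> is_cond_exp P Sigma f' g' ->
  {ae P, forall x, g x <= g' x}.
Proof.
move=> intf intf' ff' [mg intg gE] [mg' intg' g'E].
pose B := [set x | g' x < g x].
have SB : Sigma B.
  apply/measurable_subE; rewrite -[X in measurable X]setTI.
  exact: measurable_fun_ltr.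
have mB := sub_measurable SB.
have mgg' : measurable_fun B (g \- g').
  by apply: measurable_funTS; apply: measurable_funB; exact: measurable_fun_sub.
have PB0 : P B = 0%E.
  apply: (integral_le0_null _ _ _ P _ _ mB mgg') => [x|].
    by rewrite subr_gt0.
  under eq_integral do rewrite EFinB.
  rewrite integralB//; [|exact: integrableS intg|exact: integrableS intg'].
  rewrite gE// g'E// sube_le0 le_integral//; first exact: integrableS intf.
    exact: integrableS intf'.
  by move=> x _; rewrite lee_fin.
exists B; split => // x /= /negP; by rewrite -ltNge.
Qed.

Lemma is_cond_exp_unique f g g' :
  P.-integrable [set: Omega] (EFin \o f) ->
  is_cond_exp P Sigma f g -> is_cond_exp P Sigma f g' -> g = g' %[ae P].
Proof.
move=> intf fg fg'.
have := is_cond_exp_le intf intf (fun=> lexx _) fg fg'.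
have := is_cond_exp_le intf intf (fun=> lexx _) fg' fg.
by apply: filterS2 => x g'g gg' _; apply/eqP; rewrite eq_le g'g gg'.
Qed.

Lemma cond_expP f : P.-integrable [set: Omega] (EFin \o f) ->
  is_cond_exp P Sigma f (cond_exp P Sigma f).
Proof. by move=> /is_cond_exp_ex[g fg]; exact: (xgetI (cst 0) fg). Qed.

Lemma measurable_cond_exp f :
  measurable_fun [set: OmegaS] (cond_exp P Sigma f : OmegaS -> R).
Proof. by rewrite /cond_exp; case: xgetP => [g _ []|_]//. Qed.


Lemma integrable_cond_prob (A : set Omega) : measurable A ->
  P.-integrable [set: Omega] (EFin \o cond_prob P Sigma A).
Proof.
move=> mA; have int1 : P.-integrable [set: Omega] (EFin \o \1_A).
  exact: integrable_indic.
by have [] := cond_expP int1.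
Qed.

Lemma integral_cond_prob (A C : set Omega) : measurable A -> Sigma C ->
  (\int[P]_(x in C) (cond_prob P Sigma A x)%:E = P (C `&` A))%E.
Proof.
move=> mA SC; have int1 : P.-integrable [set: Omega] (EFin \o \1_A).
  exact: integrable_indic.
have [_ _ ->//] := cond_expP int1.
by rewrite integral_indic//; [rewrite setIC|exact: sub_measurable].
Qed.

Lemma is_cond_exp0 : is_cond_exp P Sigma (cst 0) (cst 0).
Proof. by split => //; exact: integrable0. Qed.

(** ** The extension T on nonnegative integrable functions *)

Section nonnegative.
Variables (f g : Omega -> R).
Hypotheses (f0 : forall x, 0 <= f x)
  (intf : P.-integrable [set: Omega] (EFin \o f)) (fg : is_cond_exp P Sigma f g).

Let fmin n x := Num.min (f x) n.+1%:R.

Let mf : measurable_fun [set: Omega] f.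
Proof. by apply/measurable_EFinP; exact: measurable_int intf. Qed.

Let fmin_ge0 n x : 0 <= fmin n x.
Proof. by rewrite le_min f0 ler0n. Qed.

Let measurable_fmin n : measurable_fun [set: Omega] (fmin n).
Proof. exact: measurable_minr. Qed.

Let integrable_fmin n : P.-integrable [set: Omega] (EFin \o fmin n).
Proof.
apply: le_integrable intf => //; first exact/measurable_EFinP.
by move=> x _; rewrite lee_fin !ger0_norm// ge_min lexx.
Qed.

Lemma cond_exp_trunc_le n : {ae P, forall x, cond_exp_trunc P Sigma f n x <= g x}.
Proof.
apply: (is_cond_exp_le (integrable_fmin n) intf) => //; last exact: cond_expP.
by move=> x; rewrite ge_min lexx.
Qed.

Lemma cond_exp_trunc_ge0 n : {ae P, forall x, 0 <= cond_exp_trunc P Sigma f n x}.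
Proof.
have int0 : P.-integrable [set: Omega] (EFin \o cst 0) by exact: integrable0.
apply: (is_cond_exp_le int0 (integrable_fmin n)) => //; last exact: cond_expP.
Qed.

Lemma cond_exp_trunc_nondecreasing :
  {ae P, forall x, nondecreasing_seq (cond_exp_trunc P Sigma f ^~ x)}.
Proof.
have : {ae P, forall x n,
    cond_exp_trunc P Sigma f n x <= cond_exp_trunc P Sigma f n.+1 x}.
  apply: ae_foralln => n.
  apply: (is_cond_exp_le (integrable_fmin n) (integrable_fmin n.+1));
    [|exact: cond_expP..].
  by move=> x; rewrite le_min !ge_min lexx/= ler_nat leqnSn orbT.
by apply: filterS => x h; apply/nondecreasing_seqP.
Qed.

Let L x := limn (cond_exp_trunc P Sigma f ^~ x).

Let cvg_L :
  {ae P, forall x, cond_exp_trunc P Sigma f n x @[n --> \oo] --> L x}.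
Proof.
have := ae_foralln cond_exp_trunc_le; have := cond_exp_trunc_nondecreasing.
apply: filterS2 => x nd ub; apply: nondecreasing_is_cvgn => //.
by exists (g x) => _ [n _ <-]; exact: ub.
Qed.

Let measurable_L : measurable_fun [set: OmegaS] (L : OmegaS -> R).
Proof. by apply: measurable_fun_limn => n; exact: measurable_cond_exp. Qed.

(** Conditional monotone convergence: the truncated conditional expectations lie
    between 0 and g, so dominated convergence passes to the limit on both sides
    of the defining identity of the conditional expectation. *)
Let is_cond_exp_L : is_cond_exp P Sigma f L.
Proof.
have [_ intg _] := fg.
have cvg_int B : measurable B -> P.-integrable B (EFin \o L) /\
    (\int[P]_(x in B) (cond_exp_trunc P Sigma f n x)%:E @[n --> \oo]
      --> \int[P]_(x in B) (L x)%:E)%E.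
  move=> mB.
  have [] // := @dominated_convergence _ _ _ P B mB
    (fun n x => (cond_exp_trunc P Sigma f n x)%:E) (EFin \o L) (EFin \o g).
  - move=> n; apply/measurable_EFinP/measurable_funTS; apply: measurable_fun_sub.
    exact: measurable_cond_exp.
  - apply/measurable_EFinP/measurable_funTS.
    exact: measurable_fun_sub measurable_L.
  - move: cvg_L; apply: filterS => x cvL _.
    by apply: cvg_EFin => //; exact: nearW.
  - exact: integrableS intg.
  - have := ae_foralln cond_exp_trunc_le; have := ae_foralln cond_exp_trunc_ge0.
    by apply: filterS2 => x g0 gg n _; rewrite lee_fin ger0_norm.
split => //; first exact: (cvg_int _ measurableT).1.
move=> B SB; have mB := sub_measurable SB.
have [_ cvL] := cvg_int _ mB.
have [|||||] := @dominated_convergence _ _ _ P B mB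
  (fun n x => (fmin n x)%:E) (EFin \o f) (EFin \o f).
- by move=> n; apply/measurable_EFinP/measurable_funTS.
- by apply/measurable_EFinP/measurable_funTS.
- apply: aeW => x _; apply: cvg_EFin; first exact: nearW.
  apply: cvg_near_cst; exists (Num.truncn (f x)) => // n /= fn.
  apply/min_idPl; rewrite (le_trans (ltW (truncnS_gt _)))// ler_nat; exact: fn.
- exact: integrableS intf.
- by apply: aeW => x n _; rewrite lee_fin ger0_norm// ge_min lexx.
move=> _ _ cvf; rewrite -(cvg_lim _ cvL)// -(cvg_lim _ cvf)//.
congr (limn _); apply/funext => n /=.
by have [_ _ ->] := cond_expP (integrable_fmin n).
Qed.

Lemma cvg_cond_exp_trunc :
  {ae P, forall x, cond_exp_trunc P Sigma f n x @[n --> \oo] --> g x}.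
Proof.
have := is_cond_exp_unique intf is_cond_exp_L fg.
by move: cvg_L; apply: filterS2 => x /[swap] /(_ I) ->.
Qed.

Lemma natural_domain_integrable : natural_domain P Sigma f.
Proof.
have [mg _ _] := fg.
split => //; exists (EFin \o g); split.
- by apply/measurable_EFinP; exact: measurable_fun_sub mg.
- exact: aeW.
move=> n; rewrite (_ : (fun y => `|f y|) = f); last first.
  by apply/funext => x; rewrite ger0_norm.
by have := cond_exp_trunc_le n; apply: filterS => x; rewrite lee_fin.
Qed.

Lemma ext_cond_expE : ext_cond_exp P Sigma f = g %[ae P].
Proof.
have int0 : P.-integrable [set: Omega] (EFin \o cst 0) by exact: integrable0.
have fE : f^\+ = f by apply/funext => x; rewrite /funrpos (max_idPl _).
have nE n : cond_exp_trunc P Sigma f^\- n = cond_exp P Sigma (cst 0).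
  congr cond_exp; apply/funext => x.
  by rewrite /funrneg (max_idPr _) ?oppr_le0// (min_idPl _).
have := is_cond_exp_unique int0 (cond_expP int0) is_cond_exp0.
move: cvg_cond_exp_trunc; apply: filterS2 => x cvg z _.
rewrite /ext_cond_exp fE (cvg_lim _ cvg)//.
by under eq_fun do rewrite nE z//; rewrite lim_cst// subr0.
Qed.

End nonnegative.

End conditional_expectation.

(** * The recurrence time as a series of indicators *)

Definition hits (T : Type) (tau : T -> T) (A : set T) (n : nat) : set T :=
  [set x | exists2 j, (j < n)%N & A (iter j tau x)].

Section hitting.
Context (T : Type) (tau : T -> T) (A : set T).
Local Notation hits := (hits T tau A).

Lemma hits0 : hits 0 = set0.
Proof. by apply/seteqP; split => // x []. Qed.

Lemma hitsS n : hits n.+1 = A `|` tau @^-1` hits n.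
Proof.
apply/seteqP; split => x /=.
  by case=> -[|j] jn Aj; [left|right; exists j => //; rewrite -iterSr].
by case=> [Ax|[j jn Aj]]; [exists 0%N|exists j.+1 => //; rewrite iterSr].
Qed.

Lemma nondecreasing_hits : {homo hits : m n / (m <= n)%N >-> (m <= n)%O}.
Proof.
move=> m n mn; apply/subsetPset => x [j jm Aj].
by exists j => //; exact: leq_trans mn.
Qed.

(** For x in A the k-th indicator is 1 exactly when n_A(x) > k, so the series
    counts the k < n_A(x); if x never returns, all its terms are 1. *)
Lemma recurrence_timeE (R : realType) (x : T) : recurrence_time R tau A x =
  (\sum_(0 <= k <oo) (\1_(A `\` tau @^-1` hits k) x)%:E)%E.
Proof.
have ge0 k : (0 <= (\1_(A `\` tau @^-1` hits k) x : R)%:E)%E by rewrite lee_fin.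
rewrite /recurrence_time; case: ifPn => [/set_mem Ax|/negP nAx]; last first.
  rewrite eseries0// => k _ _; rewrite indicE memNset// => -[Ax _].
  by apply: nAx; rewrite inE.
have [[n An]|nA] := pselect (exists n, A (iter n tau (tau x))).
- (* m + 1 is the first return time: p counts from tau x *)
  pose p n := `[< A (iter n tau (tau x)) >].
  have exp : exists n, p n by exists n; exact/asboolP.
  case: (ex_minnP exp) => m /asboolP Am mmin.
  have hitE k : \1_(A `\` tau @^-1` hits k) x = (k <= m)%N%:R :> R.
    rewrite indicE; congr (_ %:R); congr nat_of_bool; apply/idP/idP.
      move=> /set_mem[_ nh]; rewrite leqNgt; apply/negP => mk.
      by apply: nh; exists m.
    move=> km; apply/mem_set; split => // -[j jk Aj].
    have := mmin _ (asboolT Aj).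
    by rewrite leqNgt (leq_trans jk km).
  rewrite (nneseries_split 0 m.+1)//= add0n [X in _ + X]eseries0 ?adde0;
    last first.
    by move=> k mk _; rewrite hitE leqNgt mk.
  rewrite (eq_big_nat _ _ (F2 := fun=> 1%:E)); last first.
    by move=> k /andP[_]; rewrite ltnS hitE => ->.
  rewrite sumEFin sumr_const_nat subn0.
  apply/eqP; rewrite eq_le; apply/andP; split.
    apply: ereal_inf_lbound; exists m.+1 => //=; split => //.
    by rewrite -iterS iterSr.
  apply: le_ereal_inf_tmp => _ [[|k] [k0 Ak] <-] //.
  rewrite lee_fin ler_nat ltnS; apply: mmin; apply/asboolP.
  by rewrite -iterSr.
- rewrite [X in ereal_inf X](_ : _ = set0); last first.
    apply/seteqP; split => [_ [[|k] [k0 Ak] <-] //|//].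
    by apply: nA; exists k; rewrite -iterSr.
  rewrite ereal_inf0; apply/esym/eq_infty => r.
  apply: le_trans (nneseries_lim_ge (Num.truncn r).+1 (fun k _ _ => ge0 k)).
  rewrite (eq_bigr (fun=> 1%:E)); last first.
    move=> k _; rewrite indicE mem_set//; split => // -[j _ Aj].
    by apply: nA; exists j.
  by rewrite sumEFin sumr_const_nat subn0 lee_fin ltW// truncnS_gt.
Qed.

Lemma recurrence_time_ge0 (R : realType) (x : T) :
  (0 <= recurrence_time R tau A x)%E.
Proof.
by rewrite recurrence_timeE; apply: nneseries_ge0 => k _ _; rewrite lee_fin.
Qed.

End hitting.

(** * The conditional Kac formula *)

Section kac.
Local Set Implicit Arguments.
Local Unset Strict Implicit.
Context d (Omega : measurableType d) (R : realType) (P : probability Omega R).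
Variables (Sigma : set (set Omega)) (subSigma : sub_sigma_algebra Sigma).
Variables (tau : Omega -> Omega) (A : set Omega).
Hypotheses (mA : measurable A)
  (measurable_tau : forall B, measurable B -> measurable (tau @^-1` B))
  (tau_preserving : forall B C, measurable B -> Sigma C ->
    P (C `&` tau @^-1` B) = P (C `&` B)).
Local Notation hits := (hits Omega tau A).
Local Notation hit := (\bigcup_n hits n).
Local Notation mS := (sub_measurable subSigma).

Lemma measurable_hits n : measurable (hits n).
Proof.
elim: n => [|n ih]; rewrite ?hits0// hitsS.
by apply: measurableU => //; exact: measurable_tau.
Qed.

Lemma measurable_hit : measurable hit.
Proof. by apply: bigcupT_measurable; exact: measurable_hits. Qed.

Lemma subset_hit : A `<=` hit.
Proof. by move=> x Ax; exists 1%N => //; exists 0%N. Qed.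

Lemma preimage_hit : tau @^-1` hit `<=` hit.
Proof. by move=> x [n _ hx]; exists n.+1 => //; rewrite hitsS; right. Qed.

(** The telescoping behind the formula of Kac: the complement of tau^-1(U_n) in A
    is what U_(n+1) has beyond tau^-1(U_n), and tau^-1(U_n) has the same measure
    on C as U_n. *)
Lemma sum_measure_late C n : Sigma C ->
  (\sum_(0 <= k < n) P (C `&` (A `\` tau @^-1` hits k)) = P (C `&` hits n))%E.
Proof.
move=> SC; have mC := mS SC.
elim: n => [|n ih]; first by rewrite big_nil hits0 setI0 measure0.
have mt := measurable_tau (measurable_hits n).
rewrite big_nat_recr//= ih -tau_preserving//; last exact: measurable_hits.
rewrite -measureU//; [|exact: measurableI| |].
- rewrite -setIUr hitsS; congr (P (_ `&` _)).
  by rewrite setUC setDE setUIl setUCl setIT setUC.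
- by apply: measurableI => //; exact: measurableD.
- by apply/seteqP; split => x /= => [[[_ ?] [_ []]]|].
Qed.

Lemma integral_recurrence_time C : Sigma C ->
  (\int[P]_(x in C) recurrence_time R tau A x = P (C `&` hit))%E.
Proof.
move=> SC; have mC := mS SC.
have mD k : measurable (A `\` tau @^-1` hits k).
  by apply: measurableD => //; apply: measurable_tau; exact: measurable_hits.
under eq_integral do rewrite recurrence_timeE.
rewrite integral_nneseries//; last first.
  by move=> n; apply/measurable_EFinP; exact: measurable_indic.
under eq_eseriesr do rewrite integral_indic// setIC.
apply/cvg_lim => //; under eq_fun do rewrite (sum_measure_late _ SC).
rewrite setI_bigcupr; apply: nondecreasing_cvg_mu.
- by move=> n; apply: measurableI => //; exact: measurable_hits.
- by rewrite -setI_bigcupr; apply: measurableI => //; exact: measurable_hit.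
- move=> m n mn; apply/subsetPset; apply: setIS; apply/subsetPset.
  exact: nondecreasing_hits.
Qed.

(** ** The orbits meeting A and the support of the conditional probability *)

Let pos := [set x | 0 < cond_prob P Sigma A x].

Let measurable_cond_prob :
  measurable_fun [set: g_sigma_algebraType Sigma]
    (cond_prob P Sigma A : g_sigma_algebraType Sigma -> R).
Proof. exact: measurable_cond_exp. Qed.

Let Sigma_pos : Sigma pos.
Proof.
apply/(measurable_subE subSigma); rewrite -[X in measurable X]setTI.
exact: measurable_fun_ltr.
Qed.

Let SigmaC C : Sigma C -> Sigma (~` C).
Proof.
move=> /(measurable_subE subSigma) mC.
exact/(measurable_subE subSigma)/measurableC.
Qed.

Let SigmaI C D : Sigma C -> Sigma D -> Sigma (C `&` D).
Proof.
move=> /(measurable_subE subSigma) mC /(measurable_subE subSigma) mD.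
exact/(measurable_subE subSigma)/measurableI.
Qed.

(** On the complement of Q, which is in Sigma, P[A|Sigma] <= 0, so A has
    measure at most 0 there. *)
Let ae_sub_pos : {ae P, forall x, A x -> pos x}.
Proof.
have SN := SigmaC Sigma_pos.
exists (~` pos `&` A); split; first exact: measurableI (mS SN) mA.
  apply/eqP; rewrite eq_le measure_ge0 andbT -(integral_cond_prob P subSigma)//.
  rewrite -[leRHS](integral0 P (~` pos)); apply: le_integral.
  - exact: mS.
  - by apply: integrableS (integrable_cond_prob P subSigma mA) => //; exact: mS.
  - exact: integrable0.
  - by move=> x /[!inE] /negP; rewrite -leNgt lee_fin.
by move=> x /= /not_implyP[].
Qed.

(** By [sum_measure_late] on the complement of Q, the part of U_n outside Q
    splits into subsets of the null set A \ Q. *)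
Lemma ae_hit_sub_pos : {ae P, forall x, hit x -> pos x}.
Proof.
have SN := SigmaC Sigma_pos.
have hitsN n : {ae P, forall x, hits n x -> pos x}.
  exists (~` pos `&` hits n); split.
  - exact: measurableI (mS SN) (measurable_hits n).
  - rewrite -sum_measure_late// big1// => k _.
    apply: measure_negligible.
      apply: measurableI (mS SN) _; apply: measurableD => //.
      exact: measurable_tau (measurable_hits k).
    by move: ae_sub_pos; apply: negligibleS => x [npx [Ax _]] /(_ Ax).
  - by move=> x /= /not_implyP[].
by have := ae_foralln hitsN; apply: filterS => x h [n _]; exact: h.
Qed.

Hypothesis ergodic : conditionally_ergodic P Sigma tau.

(** U contains tau^-1(U), which has the same measure. *)
Lemma hit_invariant : (\1_hit : Omega -> R) \o tau = \1_hit %[ae P].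
Proof.
have mh := measurable_hit; have mt := measurable_tau mh.
exists (hit `\` tau @^-1` hit); split; first exact: measurableD.
  rewrite measureD//; last by rewrite -ge0_fin_numE// fin_num_measure.
  rewrite setIidr; last exact: preimage_hit.
  have ST : Sigma setT by apply/(measurable_subE subSigma); exact: measurableT.
  have PE : P (tau @^-1` hit) = P hit.
    by have := tau_preserving mh ST; rewrite !setTI.
  by rewrite [X in (_ - X)%E]PE subee// fin_num_measure.
move=> x /= /not_implyP[_]; apply: contra_notP => /not_andP h.
rewrite !indicE; congr (_ %:R); congr nat_of_bool.
apply/idP/idP => /set_mem hx; apply/mem_set.
  exact: preimage_hit.
by case: h => // /contrapT.
Qed.

(** By ergodicity the indicator of U is a.e. equal to some T g, and every T g is
    Sigma-measurable as a difference of pointwise limits of Sigma-measurable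
    functions. *)
Lemma hit_Sigma : exists2 C, Sigma C & {ae P, forall x, hit x <-> C x}.
Proof.
have int1 : P.-integrable [set: Omega] (EFin \o \1_hit).
  by apply: integrable_indic => //; exact: measurable_hit.
have hit0 x : 0 <= \1_hit x :> R by [].
have [g _ hitg] := ergodic
  (natural_domain_integrable subSigma hit0 int1 (cond_expP subSigma int1))
  hit_invariant.
pose G : g_sigma_algebraType Sigma -> R := ext_cond_exp P Sigma g.
have mG : measurable_fun setT G.
  apply: measurable_funB; apply: measurable_fun_limn => n;
    exact: measurable_cond_exp.
exists (G @^-1` [set 1]).
  apply/(measurable_subE subSigma); rewrite -[X in measurable X]setTI.
  exact: mG.
move: hitg; apply: filterS => x /(_ I); rewrite /G /= => <-.
rewrite indicE; split => [hx|/eqP]; first by rewrite mem_set.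
by have [/set_mem//|_] := boolP (x \in hit); rewrite eq_sym oner_eq0.
Qed.

(** With C the Sigma-version of U, the set Q \ C carries no mass of A, while
    P[A|Sigma] is positive on it. *)
Lemma ae_hit_pos : {ae P, forall x, hit x <-> pos x}.
Proof.
have [C SC hitC] := hit_Sigma.
have SD := SigmaI Sigma_pos (SigmaC SC); have mD := mS SD.
have PD0 : P (pos `&` ~` C) = 0%E.
  apply: (integral_le0_null _ _ _ P _ (cond_prob P Sigma A)) => //.
  - exact/measurable_funTS/(measurable_fun_sub subSigma measurable_cond_prob).
  - by move=> x [].
  - rewrite (integral_cond_prob P subSigma)//.
    rewrite (measure_negligible (measurableI _ _ mD mA))//.
    move: hitC; apply: negligibleS => x [[_ nCx] Ax] /= hC.
    by apply/nCx/hC/subset_hit.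
have posC : {ae P, forall x, pos x -> C x}.
  by exists (pos `&` ~` C); split => // x /= /not_implyP.
move: hitC posC ae_hit_sub_pos; apply: filterS3 => x hC pC hp; split => // /pC.
by move/hC.
Qed.

(** ** Integrability and the conditional expectation of the recurrence time *)

Let measurable_recurrence_time :
  measurable_fun [set: Omega] (recurrence_time R tau A).
Proof.
rewrite (_ : recurrence_time _ _ _ = fun x =>
  (\sum_(0 <= k <oo) (\1_(A `\` tau @^-1` hits k) x)%:E)%E); last first.
  by apply/funext => x; rewrite recurrence_timeE.
apply: ge0_emeasurable_sum => // k _.
apply/measurable_EFinP; apply: measurable_indic; apply: measurableD => //.
exact: measurable_tau (measurable_hits k).
Qed.

Lemma integrable_recurrence_time :
  P.-integrable [set: Omega] (recurrence_time R tau A).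
Proof.
apply/integrableP; split => //.
under eq_integral do rewrite gee0_abs ?recurrence_time_ge0//.
rewrite integral_recurrence_time; last first.
  by apply/(measurable_subE subSigma); exact: measurableT.
by rewrite setTI -ge0_fin_numE// fin_num_measure//; exact: measurable_hit.
Qed.

Lemma ae_recurrence_time_fin :
  {ae P, forall x, recurrence_time R tau A x \is a fin_num}.
Proof.
have := integrable_ae measurableT integrable_recurrence_time.
by apply: filterS => x; exact.
Qed.

Let measurable_fine_recurrence_time :
  measurable_fun [set: Omega] (fine \o recurrence_time R tau A).
Proof. exact: measurableT_comp. Qed.

Lemma integrable_fine_recurrence_time :
  P.-integrable [set: Omega] (EFin \o (fine \o recurrence_time R tau A)).
Proof.
apply: le_integrable integrable_recurrence_time => //.
  exact/measurable_EFinP.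
move=> x _ /=; case: (recurrence_time R tau A x) => [r||] /=;
  by rewrite ?normr0 ?leey ?lexx.
Qed.

(** Both sides of the defining identity are P(C /\ U). *)
Lemma is_cond_exp_recurrence_time :
  is_cond_exp P Sigma (fine \o recurrence_time R tau A) \1_pos.
Proof.
split.
- by apply: measurable_indic; exact/(measurable_subE subSigma).
- by apply: integrable_indic => //; exact: mS.
move=> C SC; have mC := mS SC.
transitivity (\int[P]_(x in C) recurrence_time R tau A x)%E; last first.
  apply: ae_eq_integral => //.
  - exact: measurable_funTS.
  - exact/measurable_funTS/measurable_EFinP.
  - by move: ae_recurrence_time_fin; apply: filterS => x /= h _; rewrite fineK.
rewrite integral_recurrence_time// setIC -(integral_indic P mC measurable_hit).
apply: ae_eq_integral => //.
- by apply/measurable_EFinP; apply: measurable_indic; exact: mS.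
- by apply/measurable_EFinP; apply: measurable_indic; exact: measurable_hit.
move: ae_hit_pos; apply: filterS => x [hp ph] _.
rewrite !indicE; congr (_ %:R%:E); congr nat_of_bool.
by apply/idP/idP => /set_mem h; apply/mem_set; [exact: ph|exact: hp].
Qed.

End kac.

Theorem mainTheorem5 (d : measure_display) (Omega : measurableType d)
    (R : realType) (P : probability Omega R)
    (Pcomplete : measure_is_complete P)
    (Sigma : set (set Omega)) (Sigma_sub : sub_sigma_algebra Sigma)
    (tau : Omega -> Omega)
    (tau_hyp : forall A : set Omega, measurable A ->
      [/\ measurable (tau @^-1` A),
          cond_exp P Sigma (\1_(tau @^-1` A)) = cond_exp P Sigma (\1_A)
            %[ae P] &
          exists2 B : set Omega, measurable B &
            P (A `+` tau @^-1` B) = 0%E])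
    (ergodic : conditionally_ergodic P Sigma tau)
    (A : set Omega) (mA : measurable A) :
  (* n_A is a.e. finite and represents an element of the natural domain, so
     that its conditional expectation is defined *)
  [/\ {ae P, forall x, recurrence_time R tau A x \is a fin_num},
      natural_domain P Sigma (fine \o recurrence_time R tau A) &
      ext_cond_exp P Sigma (fine \o recurrence_time R tau A)
        = \1_[set x | 0 < cond_prob P Sigma A x] %[ae P]].
Proof.
have mtau B : measurable B -> measurable (tau @^-1` B) by move=> /tau_hyp[].
have tau_preserving B C : measurable B -> Sigma C ->
    P (C `&` tau @^-1` B) = P (C `&` B).
  move=> mB SC; have [mtB BE _] := tau_hyp _ mB.
  rewrite -(integral_cond_prob P Sigma_sub mB SC).
  rewrite -(integral_cond_prob P Sigma_sub mtB SC).
  have mcond f : measurable_fun C (EFin \o cond_exp P Sigma f).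
    apply/measurable_EFinP/measurable_funTS.
    by apply: (measurable_fun_sub Sigma_sub); exact: measurable_cond_exp.
  apply: ae_eq_integral; [exact: sub_measurable SC|exact: mcond..|].
  by move: BE; apply: filterS => x BEx _; rewrite /cond_prob BEx.
have kac := is_cond_exp_recurrence_time Sigma_sub mA mtau tau_preserving ergodic.
have kac_int := integrable_fine_recurrence_time Sigma_sub mA mtau tau_preserving.
have n0 x : 0 <= (fine \o recurrence_time R tau A) x.
  by rewrite fine_ge0// recurrence_time_ge0.
split.
- exact: (ae_recurrence_time_fin Sigma_sub mA mtau tau_preserving).
- exact: (natural_domain_integrable Sigma_sub n0 kac_int kac).
- exact: (ext_cond_expE Sigma_sub n0 kac_int kac).
Qed.
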